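(* Consider an unmixed polynomial system $\mathcal{F}\in R_{A_1}\times\dots\times R_{A_s}$ and a polynomial $f_0\in R_{A_0}$, with $\mathrm{Conv}(A_i)=d_i\cdot P$ for $i=0,\dots,s$. Let $\lambda_{\min}$ be the smallest integer among the degrees of the monomials in $\mathrm{ES}_P(t)\prod_{i=0}^s(1-t^{d_i})$ standing with a non-positive coefficient. If $(f_0,\mathcal{F})$ is a semi-regular* sequence, then the tuple $(\mathcal{F},A_0,(E_0^{\lambda_{\min}},\mathbf{E}^{\lambda_{\min}}),D^{\lambda_{\min}})$ is admissible.
   Context: Let $R=\mathbb{C}[x_1,\dots,x_n]$, $\mathbb{N}=\{0,1,2,\dots\}$; for finite $E\subset\mathbb{N}^n$ let $R_E=\bigoplus_{\alpha\in E}\mathbb{C}\,x^\alpha$. Throughout, $s\ge n$, $P\subset\mathbb{R}^n$ is a full-dimensional lattice polytope (the convex hull of a finite subset of $\mathbb{N}^n$, of positive volume) with $0\in P$, $d_0,\dots,d_s$ are positive integers, and $A_0,\dots,A_s\subset\mathbb{N}^n$ are finite sets with $\mathrm{Conv}(A_i)=d_i\cdot P$. Systems $\mathcal{F}=(f_1,\dots,f_s)\in R_{A_1}\times\dots\times R_{A_s}$ of this type are called unmixed. For $\lambda\in\mathbb{N}$ and $i=0,\dots,s$: $E_i^\lambda=((\lambda-d_i)\cdot P)\cap\mathbb{N}^n$ if $\lambda\ge d_i$ and $E_i^\lambda=\emptyset$ otherwise; $\mathbf{E}^\lambda=(E_1^\lambda,\dots,E_s^\lambda)$; $D^\lambda=(\lambda\cdot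 P)\cap\mathbb{N}^n$. For a tuple of polynomials $(g_i)_{i\in I}$, $g_i=\sum_\alpha c_{i,\alpha}x^\alpha$, and finite exponent sets $(E_i)_{i\in I}$, $D$ such that $D$ contains the exponents of $x^\beta g_i$ for all $\beta\in E_i$, the Macaulay matrix $\mathrm{M}((g_i),(E_i);D)$ has rows indexed by $\alpha\in D$, columns by pairs $(i,\beta)$ with $\beta\in E_i$, and entries $c_{i,\alpha-\beta}$ (zero if $\alpha-\beta\notin\mathbb{N}^n$); $\mathrm{HF}((g_i),(E_i);D)=\#D-\operatorname{rank}\mathrm{M}((g_i),(E_i);D)$. Ehrhart series: $\mathrm{ES}_P(t)=\sum_{\lambda\ge0}\#((\lambda\cdot P)\cap\mathbb{Z}^n)\,t^\lambda$. Hilbert series of $\mathcal{F}_0=(f_0,\dots,f_s)$: $\mathrm{HS}_{\mathcal{F}_0}(t)=\sum_{\lambda\ge0}\mathrm{HF}(\mathcal{F}_0,(E_0^\lambda,\dots,E_s^\lambda);D^\lambda)\,t^\lambda$. The sequence $\mathcal{F}_0$ is semi-regular* if $\mathrm{HS}_{\mathcal{F}_0}(t)=\big[\mathrm{ES}_P(t)\prod_{i=0}^s(1-t^{d_i})\big]_+$, where $[\cdot]_+$ means that the series is truncated at its first negative coefficient (that term and all later ones are dropped). Admissible tuple: let $\mathrm{Coker}(\mathcal{F},\mathbf{E};D)$ be a matrix of size $\mathrm{HF}(\mathcal{F},\mathbf{E};D)\times\#D$ and rank $\mathrm{HF}(\mathcal{F},\mathbf{E};D)$ with $\mathrm{Coker}(\mathcal{F},\mathbf{E};D)\cdot\mathrm{M}(\mathcal{F},\mathbf{E};D)=0$,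 and for $h\in R_{A_0}$ let $N_h=\mathrm{Coker}(\mathcal{F},\mathbf{E};D)\cdot\mathrm{M}(h,E_0;D)$. The tuple $(\mathcal{F},A_0,(E_0,\mathbf{E}),D)$ is admissible if (Compatibility) $A_i+E_i\subset D$ for $i=0,\dots,s$; (Rank) there exists $h\in R_{A_0}$ with $\operatorname{rank}(N_h)=\mathrm{HF}(\mathcal{F},\mathbf{E};D)$; (Lattice) $0\in A_0$ and $\mathbb{Z}A_0=\mathbb{Z}^n$, where $\mathbb{Z}A_0$ is the set of integer combinations of elements of $A_0$.
   Formalization: The hypothesis ZA_0 = Z^n is added; without it the Lattice condition can fail, e.g. n = s = 1, P = [0,2], d_0 = d_1 = 1, A_0 = A_1 = {0,2}, f_0 = 1, f_1 = x^2, which is semi-regular* with ZA_0 = 2Z. *)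

(* Defs.v *)
From HB Require Import structures.
From mathcomp Require Import all_boot all_order all_algebra.
From mathcomp Require Import finmap.
From mathcomp Require Import boolp classical_sets cardinality reals.
From mathcomp Require Import complex mpoly.

Set Implicit Arguments.
Unset Strict Implicit.
Unset Printing Implicit Defensive.

Import Order.TTheory GRing.Theory Num.Theory.

Local Open Scope classical_set_scope.
Local Open Scope ring_scope.

Section Polytopes.
Variables (R : realType) (n : nat).
Implicit Types (S P : set 'rV[R]_n).

Definition conv_hull S : set 'rV[R]_n :=
  [set x | exists (m : nat) (v : 'I_m -> 'rV[R]_n) (w : 'I_m -> R),
     [/\ forall i, S (v i), forall i, 0 <= w i, \sum_i w i = 1
       & x = \sum_i w i *: v i]].

Definition affine_hull S : set 'rV[R]_n :=
  [set x | exists (m : nat) (v : 'I_m -> 'rV[R]_n) (w : 'I_m -> R),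
     [/\ forall i, S (v i), \sum_i w i = 1 & x = \sum_i w i *: v i]].

Definition dilate (k : nat) P : set 'rV[R]_n := [set k%:R *: x | x in P].

Definition mreal (a : 'X_{1..n}) : 'rV[R]_n := \row_i (a i)%:R.

Definition conv_exponents (A : {fset 'X_{1..n}}) : set 'rV[R]_n :=
  conv_hull [set mreal a | a in [set` A]].

Definition lattice_polytope P :=
  exists V : {fset 'X_{1..n}}, P = conv_exponents V.

(* For a polytope, having dimension [n] in this sense is the same as having
   positive volume. *)
Definition full_dimensional P := affine_hull P = setT.

(* [fset_set] returns the empty set on an infinite set; when [P] is a polytope
   the sets to which it is applied in this file are finite, see
   [in_exponents_in] and [in_lattice_points]. *)
Definition exponents_in P : {fset 'X_{1..n}} := fset_set [set a | P (mreal a)].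

Definition lattice_points P : {fset 'rV[int]_n} :=
  fset_set [set z | P (map_mx intr z)].

Definition Ehrhart P (k : nat) : int := #|` lattice_points (dilate k P)|%:Z.

Lemma conv_exponents_bounded (V : {fset 'X_{1..n}}) :
  exists M : nat, forall x, conv_exponents V x ->
    forall i, 0 <= x ord0 i <= M%:R.
Proof.
exists (\max_(a <- V) mdeg a)%N => x [m [v [w [Sv w0 w1 ->]]]] i.
have vb j : 0 <= v j ord0 i <= (\max_(a <- V) mdeg a)%N%:R.
  have [a aV <-] := Sv j; rewrite mxE ler0n ler_nat /=.
  apply: (@leq_trans (mdeg a)).
    by rewrite mdegE (bigD1 i) //= leq_addr.
  by have := @leq_bigmax_seq _ (enum_fset V) predT (@mdeg n) a aV isT.
rewrite summxE; apply/andP; split.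
  apply: sumr_ge0 => j _; rewrite mxE mulr_ge0 //.
  by case/andP: (vb j).
rewrite -[leRHS]mul1r -[X in X * _]w1 mulr_suml; apply: ler_sum => j _; rewrite mxE.
by rewrite ler_wpM2l //; case/andP: (vb j).
Qed.

Lemma finite_lattice_points P (k : nat) : lattice_polytope P ->
  finite_set [set z : 'rV[int]_n | dilate k P (map_mx intr z)].
Proof.
move=> [V ->]; have [M PM] := conv_exponents_bounded V.
pose g (u : 'rV['I_(k * M).+1]_n) : 'rV[int]_n :=
  map_mx (fun j : 'I__ => (j : nat)%:Z) u.
have : finite_set [set g u | u in [set: 'rV['I_(k * M).+1]_n]].
  by apply: finite_image; apply: finite_finset.
apply: sub_finite_set => z /= [x /PM xM xz].
have zi i : 0 <= z ord0 i <= (k * M)%N%:Z.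
  have := congr1 (fun y : 'rV[R]_n => y ord0 i) xz; rewrite /= !mxE => zx.
  have /andP[x0 xle] := xM i.
  rewrite -(ler0z R) -(ler_int R) -zx mulr_ge0 //=.
  rewrite (_ : _%:~R = k%:R * M%:R :> R) ?ler_wpM2l //.
  by rewrite -natrM -pmulrn.
exists (map_mx (fun c : int => inord `|c|%N) z) => //.
apply/rowP => i; rewrite !mxE; have /andP[z0 zle] := zi i.
by rewrite inordK ?gez0_abs // ltnS -lez_nat gez0_abs.
Qed.

Lemma finite_exponents_in P (k : nat) : lattice_polytope P ->
  finite_set [set a : 'X_{1..n} | dilate k P (mreal a)].
Proof.
move=> /(finite_lattice_points k) finP.
pose g (a : 'X_{1..n}) : 'rV[int]_n := \row_i (a i)%:Z.
have gI : injective g.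
  by move=> a b /rowP ab; apply/mnmP => i; have := ab i; rewrite !mxE => -[].
have := finite_preimage (in2W gI) finP; apply: sub_finite_set => a /=;
  congr (dilate k P _).
by apply/rowP => i; rewrite !mxE -?pmulrn.
Qed.

Lemma in_lattice_points P (k : nat) (z : 'rV[int]_n) : lattice_polytope P ->
  z \in lattice_points (dilate k P) <-> dilate k P (map_mx intr z).
Proof.
move=> /(finite_lattice_points k) finP.
by rewrite in_fset_set // inE.
Qed.

Lemma in_exponents_in P (k : nat) (a : 'X_{1..n}) : lattice_polytope P ->
  a \in exponents_in (dilate k P) <-> dilate k P (mreal a).
Proof.
move=> /(finite_exponents_in k) finP.
by rewrite in_fset_set // inE.
Qed.

Definition integer_span (A : {fset 'X_{1..n}}) : set 'rV[int]_n :=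
  [set z | exists c : 'X_{1..n} -> int,
     z = \sum_(a <- A) c a *: (\row_i (a i)%:Z)].

End Polytopes.

Section Macaulay.
Variables (K : fieldType) (n : nat).

Definition supported_in (A : {fset 'X_{1..n}}) (p : {mpoly K[n]}) :=
  {subset msupp p <= A}.

Section Matrix.
Variables (I : finType) (g : I -> {mpoly K[n]}) (E : I -> {fset 'X_{1..n}})
  (D : {fset 'X_{1..n}}).

Definition Macaulay : 'M[K]_(#|{: D}|, #|{: {i : I & E i}}|) :=
  \matrix_(r, c) let a := val (enum_val r) in
                 let i := tag (enum_val c) in
                 let b := val (tagged (enum_val c)) in
                 if (b <= a)%MM then (g i)@_(a - b) else 0.

Definition HF : nat := (#|{: D}| - \rank Macaulay)%N.

Definition is_coker (C : 'M[K]_(HF, #|{: D}|)) :=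
  \rank C = HF /\ C *m Macaulay = 0.

Lemma is_coker_exists : exists C, is_coker C.
Proof.
have rk : \rank (kermx Macaulay) = HF by rewrite mxrank_ker.
exists (castmx (rk, erefl) (row_base (kermx Macaulay))); split.
  by case: _ / rk; rewrite castmx_id eq_row_base.
case: _ / rk; rewrite castmx_id; apply/eqP; rewrite -sub_kermx.
by rewrite eq_row_base.
Qed.

End Matrix.

Definition Macaulay1 (h : {mpoly K[n]}) (E D : {fset 'X_{1..n}}) :=
  Macaulay (fun _ : 'I_1 => h) (fun _ : 'I_1 => E) D.

(* A family indexed by 0, ..., s has index type ['I_s.+1]; its members of index
   1, ..., s are those at [lift ord0 i] for [i : 'I_s]. *)
Definition tail_family s (T : Type) (u : 'I_s.+1 -> T) (i : 'I_s) : T :=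
  u (lift ord0 i).

(* The tuple (F, A_0, (E_0, E), D), with A_0, ..., A_s and E_0, ..., E_s each
   given as one family. Any two matrices [C] as in [adm_rank] differ by an
   invertible left factor, so that the choice of [C] does not matter; one
   exists by [is_coker_exists]. *)
Record admissible s (F : 'I_s -> {mpoly K[n]})
    (A E : 'I_s.+1 -> {fset 'X_{1..n}}) (D : {fset 'X_{1..n}}) : Prop := {
  adm_compatibility :
    forall i a b, a \in A i -> b \in E i -> (a + b)%MM \in D;
  adm_rank :
    exists2 h, supported_in (A ord0) h &
      forall C, is_coker (g := F) (E := tail_family E) (D := D) C ->
        \rank (C *m Macaulay1 h (E ord0) D) = HF F (tail_family E) D;
  adm_lattice_zero : 0%MM \in A ord0;
  adm_lattice_span : integer_span (A ord0) = setT
}.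

End Macaulay.

(* A formal power series is represented by its sequence of coefficients. *)
Definition series_mul (u v : nat -> int) (k : nat) : int :=
  \sum_(j < k.+1) u j * v (k - j)%N.

Definition series_trunc (u : nat -> int) (k : nat) : int :=
  if [forall j : 'I_k.+1, 0 <= u j] then u k else 0.

Section SemiRegular.
Variables (R : realType) (n : nat) (P : set 'rV[R]_n).
Variables (s : nat) (d : 'I_s.+1 -> nat).

Definition D_ (k : nat) : {fset 'X_{1..n}} := exponents_in (dilate k P).

Definition E_ (k : nat) (i : 'I_s.+1) : {fset 'X_{1..n}} :=
  if (d i <= k)%N then exponents_in (dilate (k - d i) P) else fset0.

Definition expected_series : nat -> int :=
  series_mul (Ehrhart P) (fun k => (\prod_i (1 - 'X^(d i)) : {poly int})`_k).

Definition Hilbert_series (f : 'I_s.+1 -> {mpoly R[i][n]}) (k : nat) : int :=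
  (HF f (E_ k) (D_ k))%:Z.

Definition semi_regular_star (f : 'I_s.+1 -> {mpoly R[i][n]}) :=
  forall k, Hilbert_series f k = series_trunc expected_series k.

(* A monomial with coefficient zero counts as one with non-positive
   coefficient. *)
Definition is_lambda_min (k : nat) :=
  expected_series k <= 0 /\ forall j, expected_series j <= 0 -> (k <= j)%N.

End SemiRegular.

(* Main.v *)
(* The coefficient of the expected series at [lambda_min] is nonpositive, so
   semi-regularity makes the Macaulay matrix of [(f_0, F)] surjective in that
   degree. Hence [h = f_0] witnesses the rank condition: a row vector killing
   the columns of [F] and those of [f_0] is zero. The exponents being
   nonnegative, [0] is a vertex of the convex hull of [A_0], hence in [A_0]. *)

Require Import Defs.
From HB Require Import structures.
From mathcomp Require Import all_boot all_order all_algebra.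
From mathcomp Require Import finmap.
From mathcomp Require Import boolp classical_sets cardinality reals.
From mathcomp Require Import complex mpoly.

Set Implicit Arguments.
Unset Strict Implicit.
Unset Printing Implicit Defensive.

Import Order.TTheory GRing.Theory Num.Theory.

Local Open Scope classical_set_scope.
Local Open Scope ring_scope.

Section Convexity.
Variables (R : realType) (n : nat).
Implicit Types (A V : {fset 'X_{1..n}}) (P : set 'rV[R]_n).

Lemma mrealD (a b : 'X_{1..n}) : mreal R (a + b)%MM = mreal R a + mreal R b.
Proof. by apply/rowP => i; rewrite !mxE mnmDE natrD. Qed.

Lemma mreal_conv_exponents A a : a \in A -> conv_exponents A (mreal R a).
Proof.
move=> aA; exists 1%N, (fun=> mreal R a), (fun=> 1).
by split=> [_|_||]; [exists a | | rewrite big_ord1 | rewrite big_ord1 scale1r].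
Qed.

Lemma conv_hull_convex (S : set 'rV[R]_n) x y (t u : R) :
  conv_hull S x -> conv_hull S y -> 0 <= t -> 0 <= u -> t + u = 1 ->
  conv_hull S (t *: x + u *: y).
Proof.
move=> [m [v [w [Sv w0 w1 ->]]]] [m' [v' [w' [Sv' w'0 w'1 ->]]]] t0 u0 tu.
(* The two families of points are concatenated, their weights scaled by [t] and [u]. *)
exists (m + m')%N, (fun i => match split i with inl j => v j | inr j => v' j end),
  (fun i => match split i with inl j => t * w j | inr j => u * w' j end).
have spl (j : 'I_m) : split (lshift m' j) = inl j by rewrite (unsplitK (inl j)).
have spr (j : 'I_m') : split (rshift m j) = inr j by rewrite (unsplitK (inr j)).
split=> [i|i||].
- by case: split.
- by case: split => j; rewrite mulr_ge0.
- rewrite big_split_ord /= (eq_bigr (fun j => t * w j)) => [|j _]; last by rewrite spl.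
  rewrite [X in _ + X](eq_bigr (fun j => u * w' j)) => [|j _]; last by rewrite spr.
  by rewrite -!mulr_sumr w1 w'1 !mulr1.
- rewrite big_split_ord /= !scaler_sumr; congr (_ + _).
    by apply: eq_bigr => j _; rewrite spl scalerA.
  by apply: eq_bigr => j _; rewrite spr scalerA.
Qed.

(** By convexity: [k p + l q] is [k + l] times the mean of [p] and [q] with weights [k / (k + l)]
    and [l / (k + l)]. Positivity of [k] makes the denominator nonzero. *)
Lemma dilateD P (k l : nat) x y : lattice_polytope P -> (0 < k)%N ->
  dilate k P x -> dilate l P y -> dilate (k + l) P (x + y).
Proof.
move=> [V ->] k0 [p Pp <-] [q Pq <-].
have kl0 : (k + l)%:R != 0 :> R by rewrite pnatr_eq0 addn_eq0 negb_and -lt0n k0.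
exists ((k%:R / (k + l)%:R) *: p + (l%:R / (k + l)%:R) *: q).
  by apply: conv_hull_convex; rewrite ?divr_ge0 // -mulrDl -natrD divff.
by rewrite scalerDr !scalerA ![(k + l)%:R * _]mulrC !divfK.
Qed.

Lemma conv_exponents0 A : conv_exponents A (0 : 'rV[R]_n) -> 0%MM \in A.
Proof.
move=> [m [v [w [Av w0 w1 v0]]]].
have [j wj] : exists j, w j != 0.
  apply/existsP; apply: contra_eqT w1; rewrite negb_exists => /forallP w_eq0.
  rewrite big1 => [|i _]; first by rewrite eq_sym oner_neq0.
  by apply/eqP; rewrite -[_ == _]negbK.
have [a aA av] := Av j.
suff -> : 0%MM = a by [].
apply/mnmP => i; rewrite mnm0E.
(* Coordinate [i] of the combination is a vanishing sum of nonnegative terms, so each term vanishes;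
   in term [j] the weight is nonzero, hence [a i = 0]. *)
have wv_ge0 k : 0 <= w k * v k ord0 i.
  by have [b _ <-] := Av k; rewrite mulr_ge0 // mxE ler0n.
have /eqP := congr1 (fun x : 'rV_n => x ord0 i) v0.
rewrite summxE mxE eq_sym (eq_bigr (fun k => w k * v k ord0 i)) => [|k _]; last first.
  by rewrite mxE.
rewrite psumr_eq0 // => /allP/(_ j); rewrite mem_index_enum => /(_ isT) /=.
by rewrite mulf_eq0 (negbTE wj) -av mxE pnatr_eq0 => /eqP.
Qed.

End Convexity.

Section MacaulayKernel.
Variables (K : fieldType) (n : nat).
Implicit Type D : {fset 'X_{1..n}}.

(** Unpacks the column index into a pair [i], [b], so that kernels of Macaulay matrices of different
    families can be compared column by column. *)
Lemma mul_Macaulay_eq0 (I : finType) (g : I -> {mpoly K[n]})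
    (E : I -> {fset 'X_{1..n}}) D (v : 'rV[K]_#|{: D}|) :
  v *m Macaulay g E D = 0 <->
  forall i b, b \in E i ->
    \sum_r v ord0 r * (let a := val (enum_val r) in
                       if (b <= a)%MM then (g i)@_(a - b) else 0) = 0.
Proof.
split=> [vM i b bE|vM].
  have := congr1 (fun x : 'rV_ _ => x ord0 (enum_rank
    (Tagged (fun i => E i) (FSetSub bE) : {i : I & E i}))) vM.
  rewrite /= !mxE => vM0; rewrite -[RHS]vM0.
  by apply: eq_bigr => r _; rewrite mxE enum_rankK.
apply/rowP => c; rewrite !mxE.
rewrite -[RHS](vM (tag (enum_val c)) (val (tagged (enum_val c)))) ?fsvalP //.
by apply: eq_bigr => r _; rewrite mxE.
Qed.

Lemma rank_coker_Macaulay1 s (f : 'I_s.+1 -> {mpoly K[n]})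
    (E : 'I_s.+1 -> {fset 'X_{1..n}}) D
    (C : 'M_(HF (tail_family f) (tail_family E) D, #|{: D}|)) :
  HF f E D = 0%N -> is_coker C ->
  \rank (C *m Macaulay1 (f ord0) (E ord0) D) =
    HF (tail_family f) (tail_family E) D.
Proof.
(* [HF] is a truncated difference, so its vanishing only says that [#|{: D}|] is at most the rank;
   [rank_leq_row] then gives independent rows. *)
move=> /eqP; rewrite subn_eq0 => full [rkC CM].
apply/eqP; apply: inj_row_free => u; rewrite mulmxA => uCM1.
have uCM : u *m C *m Macaulay (tail_family f) (tail_family E) D = 0.
  by rewrite -mulmxA CM mulmx0.
apply: (row_free_inj (_ : row_free C)); first exact/eqP.
rewrite mul0mx; apply: (row_free_inj (_ : row_free (Macaulay f E D))).
  by rewrite /row_free eqn_leq rank_leq_row.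
rewrite mul0mx; apply/mul_Macaulay_eq0 => i b.
(* The columns of the whole family are those of its tail, killed by [C], and those of [f ord0],
   killed by the choice of [u]. *)
case: (unliftP ord0 i) => [j|] -> bE.
  by move/mul_Macaulay_eq0: uCM; apply.
by move/mul_Macaulay_eq0: uCM1 => /(_ ord0); apply.
Qed.

End MacaulayKernel.

(** A negative coefficient is cut off; one that survives is also nonnegative, hence zero. *)
Lemma series_trunc_le0 (u : nat -> int) k : u k <= 0 -> series_trunc u k = 0.
Proof.
rewrite /series_trunc => uk; case: ifPn => // /forallP /(_ ord_max) /= uk0.
by apply/eqP; rewrite eq_le uk uk0.
Qed.

Theorem theorem3p3 (R : realType) (n s : nat) (P : set 'rV[R]_n)
    (d : 'I_s.+1 -> nat) (A : 'I_s.+1 -> {fset 'X_{1..n}})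
    (f : 'I_s.+1 -> {mpoly R[i][n]}) (lambda_min : nat)
    (le_n_s : (n <= s)%N)
    (P_lattice : lattice_polytope P)
    (P_full : full_dimensional P)
    (P_zero : P 0)
    (d_gt0 : forall i, (0 < d i)%N)
    (A_conv : forall i, conv_exponents (A i) = dilate (d i) P)
    (f_supp : forall i, supported_in (A i) (f i))
    (* Not implied by the other hypotheses: take n = s = 1, P = [0, 2],
       d = (1, 1), A_0 = A_1 = {0, 2} and f = (1, x^2). *)
    (A0_span : integer_span (A ord0) = setT)
    (lambda_minP : is_lambda_min P d lambda_min)
    (f_semi_regular : semi_regular_star P d f) :
  admissible (tail_family f) A (E_ P d lambda_min) (D_ P lambda_min).
Proof.
split=> //.
- move=> i a b aA; rewrite /E_; case: ifP => [dk|]; last by rewrite in_fset0.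
  move=> /(in_exponents_in _ _ P_lattice) bP.
  (* Split [lambda_min] as [d i + (lambda_min - d i)]: the first dilate contains [a], the second
     [b]. *)
  apply/in_exponents_in => //; rewrite mrealD -(subnKC dk).
  by apply: dilateD => //; rewrite -A_conv; apply: mreal_conv_exponents.
- exists (f ord0) => // C; apply: rank_coker_Macaulay1.
  have [exp_le0 _] := lambda_minP.
  by have := f_semi_regular lambda_min; rewrite series_trunc_le0 // => -[].
- apply: (@conv_exponents0 R); rewrite A_conv.
  by exists 0; rewrite ?scaler0.
Qed.
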